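(* Let $d\le n$ and $k\le n$ be positive integers, $\bm a_1,\dots,\bm a_n\in\mathbb{R}^d$, and $\lambda>0$. For $S\subseteq[n]$ let $$f(S):=\operatorname{tr}\left(\left(\sum_{i\in S}\bm a_i\bm a_i^{\top}+\lambda \bm I_d\right)^{-1}\right),\qquad z_k:=\min_{S\subseteq[n]}\{f(S):|S|=k\}.$$ Let $S_F$ and $S_B$ be the outputs of the forward greedy algorithm and of the backward greedy algorithm described in the context. For $k\in[d-1]$, the forward greedy algorithm has approximation ratio $\frac{d-1}{d-k}$, that is, $$f(S_F)\le\frac{d-1}{d-k}\,z_k.$$ For $k\in[d,n]$, the backward greedy algorithm has approximation ratio $\frac{n-d+1}{k-d+1}$, that is, $$f(S_B)\le\frac{n-d+1}{k-d+1}\,z_k.$$ In addition, the running time complexities of the forward and backward greedy algorithms are $O(knd^2)$ and $O((n-k)nd^2)$, respectively.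
   Context: $[n]=\{1,\dots,n\}$ and $[s,n]=\{s,\dots,n\}$; $\bm I_d$ is the $d\times d$ identity matrix. Forward greedy algorithm: initialize $S_F=\emptyset$ and $\bm\Lambda=\frac1\lambda\bm I_d$. Repeat $k$ times: compute $i^*\in\arg\max_{i\in[n]\setminus S_F}\frac{\bm a_i^{\top}\bm\Lambda\bm\Lambda\bm a_i}{1+\bm a_i^{\top}\bm\Lambda\bm a_i}$; update $S_F\leftarrow S_F\cup\{i^*\}$ and $\bm\Lambda\leftarrow\bm\Lambda-\frac{\bm\Lambda\bm a_{i^*}\bm a_{i^*}^{\top}\bm\Lambda}{1+\bm a_{i^*}^{\top}\bm\Lambda\bm a_{i^*}}$. Output $S_F$. Backward greedy algorithm: initialize $S_B=[n]$ and $\bm\Lambda=\left(\sum_{j\in[n]}\bm a_j\bm a_j^{\top}+\lambda\bm I_d\right)^{-1}$. Repeat $n-k$ times: compute $i^*\in\arg\min_{i\in S_B}\frac{\bm a_i^{\top}\bm\Lambda\bm\Lambda\bm a_i}{1-\bm a_i^{\top}\bm\Lambda\bm a_i}$; update $S_B\leftarrow S_B\setminus\{i^*\}$ and $\bm\Lambda\leftarrow\bm\Lambda+\frac{\bm\Lambda\bm a_{i^*}\bm a_{i^*}^{\top}\bm\Lambda}{1-\bm a_{i^*}^{\top}\bm\Lambda\bm a_{i^*}}$. Output $S_B$.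
   Formalization: For the backward greedy algorithm the running time O((n-k)nd^2) is claimed for k<n only; at k=n this expression is 0 although initialization takes positive time, so the bound O(nd^2) is given there instead. *)

(* Defs.v *)
From mathcomp Require Import all_boot all_order all_algebra.

Set Implicit Arguments.
Unset Strict Implicit.
Unset Printing Implicit Defensive.
Import Order.TTheory GRing.Theory Num.Theory.
Local Open Scope ring_scope.

(* Throughout, [n] = {1, ..., n} is modelled by 'I_n = {0, ..., n.-1}. *)

Definition gram (R : realFieldType) (n d : nat) (a : 'I_n -> 'cV[R]_d)
    (lam : R) (S : {set 'I_n}) : 'M[R]_d :=
  \sum_(i in S) a i *m (a i)^T + lam%:M.

Definition fobj (R : realFieldType) (n d : nat) (a : 'I_n -> 'cV[R]_d)
    (lam : R) (S : {set 'I_n}) : R :=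
  \tr (invmx (gram a lam S)).

(* For k <= n the starting set of the arg min has cardinality k, so that it is
   feasible and zopt is the minimum of fobj over the k-subsets. *)
Definition zopt (R : realFieldType) (n d : nat) (a : 'I_n -> 'cV[R]_d)
    (lam : R) (k : nat) : R :=
  fobj a lam
    [arg min_(S < [set i : 'I_n | (i < k)%N] | #|S| == k) fobj a lam S]%O.

Definition qform (R : realFieldType) (d : nat) (A : 'M[R]_d) (v : 'cV[R]_d) : R :=
  (v^T *m A *m v) 0 0.

Definition forward_score (R : realFieldType) (d : nat) (L : 'M[R]_d)
    (v : 'cV[R]_d) : R :=
  qform (L *m L) v / (1 + qform L v).

Definition forward_update (R : realFieldType) (d : nat) (L : 'M[R]_d)
    (v : 'cV[R]_d) : 'M[R]_d :=
  L - (1 + qform L v)^-1 *: (L *m v *m v^T *m L).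

Definition backward_score (R : realFieldType) (d : nat) (L : 'M[R]_d)
    (v : 'cV[R]_d) : R :=
  qform (L *m L) v / (1 - qform L v).

Definition backward_update (R : realFieldType) (d : nat) (L : 'M[R]_d)
    (v : 'cV[R]_d) : 'M[R]_d :=
  L + (1 - qform L v)^-1 *: (L *m v *m v^T *m L).

(* forward_state a lam t S L : after t iterations the algorithm may be in the
   state (S, L); several states are reachable when the arg max is not unique. *)
Inductive forward_state (R : realFieldType) (n d : nat) (a : 'I_n -> 'cV[R]_d)
    (lam : R) : nat -> {set 'I_n} -> 'M[R]_d -> Prop :=
| forward_init : forward_state a lam 0 set0 (lam^-1)%:M
| forward_step t S L i :
    forward_state a lam t S L ->
    i \notin S ->
    (forall j, j \notin S -> forward_score L (a j) <= forward_score L (a i)) ->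
    forward_state a lam t.+1 (i |: S) (forward_update L (a i)).

Inductive backward_state (R : realFieldType) (n d : nat) (a : 'I_n -> 'cV[R]_d)
    (lam : R) : nat -> {set 'I_n} -> 'M[R]_d -> Prop :=
| backward_init : backward_state a lam 0 setT (invmx (gram a lam setT))
| backward_step t S L i :
    backward_state a lam t S L ->
    i \in S ->
    (forall j, j \in S -> backward_score L (a i) <= backward_score L (a j)) ->
    backward_state a lam t.+1 (S :\ i) (backward_update L (a i)).

Definition forward_output (R : realFieldType) (n d : nat)
    (a : 'I_n -> 'cV[R]_d) (lam : R) (k : nat) (S : {set 'I_n}) : Prop :=
  exists L, forward_state a lam k S L.

Definition backward_output (R : realFieldType) (n d : nat)
    (a : 'I_n -> 'cV[R]_d) (lam : R) (k : nat) (S : {set 'I_n}) : Prop :=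
  exists L, backward_state a lam (n - k) S L.

(* Running time is measured in the unit-cost real RAM model.  A program over a
   scalar type T is a tree of instructions: loading the constant 0 or 1, an
   arithmetic operation, a comparison (Less x y branches on x < y), or Step, a
   unit charged for any other action (loop control, writing an array entry,
   testing or changing membership in a set stored as a bit array).  Each
   instruction costs 1, including the fetching of its operands.
   The algorithms below are programs over an arbitrary type T, so that the only
   scalars they can produce or test are obtained by charged instructions. *)
Inductive arith := Add | Sub | Mul | Div.

Inductive prog (T A : Type) : Type :=
| Ret of A
| Const of bool & (T -> prog T A)
| Arith of arith & T & T & (T -> prog T A)
| Less of T & T & (bool -> prog T A)
| Step of prog T A.
Arguments Ret {T A}.

Fixpoint bind (T A B : Type) (p : prog T A) (q : A -> prog T B) : prog T B :=
  match p with
  | Ret x => q x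
  | Const b c => Const b (fun z => bind (c z) q)
  | Arith o x y c => Arith o x y (fun z => bind (c z) q)
  | Less x y c => Less x y (fun b => bind (c b) q)
  | Step p' => Step (bind p' q)
  end.

Notation "'let*' x ':=' p 'in' q" := (bind p (fun x => q))
  (at level 200, x name, p at level 100, q at level 200, right associativity).

Definition eval_arith (R : realFieldType) (o : arith) (x y : R) : R :=
  match o with
  | Add => x + y
  | Sub => x - y
  | Mul => x * y
  | Div => x / y
  end.

Definition tick (A : Type) (r : A * nat) : A * nat := (r.1, r.2.+1).

Fixpoint run (R : realFieldType) (A : Type) (p : prog R A) : A * nat :=
  match p with
  | Ret x => (x, 0%N)
  | Const b c => tick (run (c b%:R))
  | Arith o x y c => tick (run (c (eval_arith o x y)))
  | Less x y c => tick (run (c (x < y)))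
  | Step p' => tick (run p')
  end.

Definition output (R : realFieldType) (A : Type) (p : prog R A) : A := (run p).1.
Definition cost (R : realFieldType) (A : Type) (p : prog R A) : nat := (run p).2.

Definition const (T : Type) (b : bool) : prog T T := Const b Ret.
Definition op (T : Type) (o : arith) (x y : T) : prog T T := Arith o x y Ret.
Definition less (T : Type) (x y : T) : prog T bool := Less x y Ret.
Definition act (T A : Type) (x : A) : prog T A := Step (Ret x).

Fixpoint loop (T I A : Type) (s : seq I) (body : I -> A -> prog T A) (x : A) :
    prog T A :=
  if s is i :: s' then Step (let* y := body i x in loop s' body y) else Ret x.

(* A fresh array is allocated (its initial content is irrelevant) and its
   entries are then computed and written one by one. *)
Definition write_mx (T : Type) (p q : nat) (i : 'I_p) (j : 'I_q) (z : T)
    (A : 'M[T]_(p, q)) : prog T 'M[T]_(p, q) :=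
  act T (\matrix_(i', j') if (i' == i) && (j' == j) then z else A i' j').

Definition build_mx (T : Type) (p q : nat) (e : 'I_p -> 'I_q -> prog T T) :
    prog T 'M[T]_(p, q) :=
  let* z := const T false in
  loop (enum 'I_p) (fun i A =>
    loop (enum 'I_q) (fun j A' => let* x := e i j in write_mx i j x A') A)
    (const_mx z).

Definition sum_prog (T : Type) (d : nat) (e : 'I_d -> prog T T) : prog T T :=
  let* z := const T false in
  loop (enum 'I_d) (fun j s => let* x := e j in op Add s x) z.

Definition dot_prog (T : Type) (d : nat) (u v : 'cV[T]_d) : prog T T :=
  sum_prog (fun j => op Mul (u j 0) (v j 0)).

Definition mulmxv_prog (T : Type) (d : nat) (L : 'M[T]_d) (v : 'cV[T]_d) :
    prog T 'cV[T]_d :=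
  build_mx (fun i _ => sum_prog (fun j => op Mul (L i j) (v j 0))).

Definition mulvmx_prog (T : Type) (d : nat) (v : 'cV[T]_d) (L : 'M[T]_d) :
    prog T 'rV[T]_d :=
  build_mx (fun _ j => sum_prog (fun i => op Mul (v i 0) (L i j))).

(* In the next two programs fwd selects the signs of the forward algorithm, and
   ~~ fwd those of the backward one. *)
Definition score_prog (T : Type) (d : nat) (fwd : bool) (L : 'M[T]_d)
    (v : 'cV[T]_d) : prog T T :=
  let* u := mulmxv_prog L v in
  let* w := mulmxv_prog L u in
  let* num := dot_prog v w in
  let* q := dot_prog v u in
  let* one := const T true in
  let* den := op (if fwd then Add else Sub) one q in
  op Div num den.

Definition update_prog (T : Type) (d : nat) (fwd : bool) (L : 'M[T]_d)
    (v : 'cV[T]_d) : prog T 'M[T]_d :=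
  let* u := mulmxv_prog L v in
  let* w := mulvmx_prog v L in
  let* q := dot_prog v u in
  let* one := const T true in
  let* den := op (if fwd then Add else Sub) one q in
  build_mx (fun i j =>
    let* x := op Mul (u i 0) (w 0 j) in
    let* y := op Div x den in
    op (if fwd then Sub else Add) (L i j) y).

Definition scalar_inv_prog (T : Type) (d : nat) (lam : T) : prog T 'M[T]_d :=
  let* one := const T true in
  let* c := op Div one lam in
  build_mx (fun i j => if i == j then act T c else const T false).

Definition mem_prog (T : Type) (n : nat) (i : 'I_n) (S : {set 'I_n}) :
    prog T bool :=
  act T (i \in S).

(* Linear scan of the indices i with (i \in S) = b for the best score: the
   largest one if mx, the smallest one otherwise. *)
Definition select_prog (T : Type) (n : nat) (mx b : bool) (S : {set 'I_n})
    (score : 'I_n -> prog T T) : prog T (option ('I_n * T)) :=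
  loop (enum 'I_n) (fun i best =>
    let* c := mem_prog T i S in
    if c != b then Ret best else
    let* s := score i in
    if best is Some (_, s0) then
      let* better := (if mx then less s0 s else less s s0) in
      Ret (if better then Some (i, s) else best)
    else Ret (Some (i, s))) None.

Definition forward_prog (T : Type) (n d : nat) (a : 'I_n -> 'cV[T]_d) (lam : T)
    (k : nat) : prog T {set 'I_n} :=
  let* S0 := loop (enum 'I_n) (fun i S => act T (S :\ i)) set0 in
  let* L0 := scalar_inv_prog d lam in
  let* st := loop (iota 0 k) (fun _ st =>
    let: (U, L) := st in
    let* best := select_prog true false U (fun i => score_prog true L (a i)) in
    if best is Some (i, _) then
      let* U' := act T (i |: U) in
      let* L' := update_prog true L (a i) in
      Ret (U', L')
    else Ret st) (S0, L0) in
  Ret st.1.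

(* The initial inverse is obtained from lam^-1 I by n successive rank-one
   (Sherman-Morrison) updates, that is, in O(n d^2) steps. *)
Definition backward_prog (T : Type) (n d : nat) (a : 'I_n -> 'cV[T]_d) (lam : T)
    (k : nat) : prog T {set 'I_n} :=
  let* S0 := loop (enum 'I_n) (fun i S => act T (i |: S)) set0 in
  let* M0 := scalar_inv_prog d lam in
  let* L0 := loop (enum 'I_n) (fun i L => update_prog true L (a i)) M0 in
  let* st := loop (iota 0 (n - k)) (fun _ st =>
    let: (U, L) := st in
    let* best := select_prog false true U (fun i => score_prog false L (a i)) in
    if best is Some (i, _) then
      let* U' := act T (U :\ i) in
      let* L' := update_prog false L (a i) in
      Ret (U', L')
    else Ret st) (S0, L0) in
  Ret st.1.

(* Main.v *)
(* Forward: the first selected index maximizes |a_i|^2 = M, so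
   f(S_F) <= (d - 1)/lam + 1/(lam + M).  Conversely a Gram matrix of k vectors
   has at least d - k zero eigenvalues and trace at most k M, so convexity of
   the inverse gives f(S) >= (d - k)/lam + k/(lam + M) whenever |S| = k.
   Backward: averaging the scores with the weights 1 - a_j^T L a_j shows that
   removing the selected element from a set of size s multiplies f by at most
   (s - d + 1)/(s - d); these factors telescope, and f([n]) <= z_k. *)

Require Import Defs.
From mathcomp Require Import all_boot all_order all_algebra.
From mathcomp Require Import reals.
From mathcomp Require Import zify ring lra.

Set Implicit Arguments.
Unset Strict Implicit.
Unset Printing Implicit Defensive.
Import Order.TTheory GRing.Theory Num.Theory.
Local Open Scope ring_scope.

(** Symmetry is required separately because [qform A] sees only the symmetric part of [A]. *)
Definition posdef (R : realFieldType) (d : nat) (A : 'M[R]_d) : Prop :=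
  A^T = A /\ forall v, v != 0 -> 0 < qform A v.

(** * Positive definite matrices, rank-one updates and traces of inverses *)

Section PositiveDefinite.
Variable R : realFieldType.
Implicit Types (d k : nat) (c lam : R).

(** In trace form, a sum of quadratic forms over vectors becomes one trace against the sum of their
    rank-one matrices. *)
Lemma qform_mxtrace d (A : 'M[R]_d) v : qform A v = \tr (A *m (v *m v^T)).
Proof. by rewrite mulmxA mxtrace_mulC mulmxA /qform /mxtrace big_ord1. Qed.

Lemma qformD d (A B : 'M[R]_d) v : qform (A + B) v = qform A v + qform B v.
Proof. by rewrite !qform_mxtrace mulmxDl mxtraceD. Qed.

Lemma posdef_qform_ge0 d (A : 'M[R]_d) v : posdef A -> 0 <= qform A v.
Proof.
case=> _ A0; have [->|/A0/ltW//] := eqVneq v 0.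
by rewrite /qform mulmx0 mxE.
Qed.

Definition sqnorm d (v : 'cV[R]_d) : R := (v^T *m v) 0 0.

Lemma sqnormE d (v : 'cV[R]_d) : sqnorm v = \sum_i v i 0 ^+ 2.
Proof. by rewrite /sqnorm mxE; apply: eq_bigr => i _; rewrite mxE expr2. Qed.

Lemma sqnorm_ge0 d (v : 'cV[R]_d) : 0 <= sqnorm v.
Proof. by rewrite sqnormE sumr_ge0 // => i _; rewrite sqr_ge0. Qed.

Lemma sqnorm_gt0 d (v : 'cV[R]_d) : v != 0 -> 0 < sqnorm v.
Proof.
move=> v0; rewrite lt_neqAle sqnorm_ge0 andbT sqnormE.
apply: contra v0; rewrite eq_sym psumr_eq0 => [/allP v0|i _]; last exact: sqr_ge0.
apply/eqP/matrixP => i j; rewrite ord1 mxE.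
by have := v0 i (mem_index_enum i); rewrite sqrf_eq0 => /eqP.
Qed.

Lemma qform_scalar_mx d c (v : 'cV[R]_d) : qform c%:M v = c * sqnorm v.
Proof. by rewrite /qform mul_mx_scalar -scalemxAl mxE. Qed.

Lemma posdef_scalar d lam : 0 < lam -> posdef (lam%:M : 'M_d).
Proof.
move=> lam0; split=> [|v v0]; first by rewrite tr_scalar_mx.
by rewrite qform_scalar_mx mulr_gt0 ?sqnorm_gt0.
Qed.

Lemma qform_tr_mul m d (B : 'M[R]_(m, d)) v :
  qform (B^T *m B) v = sqnorm (B *m v).
Proof. by rewrite /qform /sqnorm trmx_mul !mulmxA. Qed.

Lemma qform_tr_mul_ge0 m d (B : 'M[R]_(m, d)) v : 0 <= qform (B^T *m B) v.
Proof. by rewrite qform_tr_mul sqnorm_ge0. Qed.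

Lemma posdef_add_tr_mul m d (A : 'M[R]_d) (B : 'M[R]_(m, d)) :
  posdef A -> posdef (A + B^T *m B).
Proof.
case=> As A0; split=> [|v v0].
  by rewrite raddfD /= As trmx_mul trmxK.
by rewrite qformD ltr_wpDr ?A0 ?qform_tr_mul_ge0.
Qed.

Lemma posdef_add_rank1 d (A : 'M[R]_d) (v : 'cV_d) :
  posdef A -> posdef (A + v *m v^T).
Proof. by move=> Ap; rewrite -{1}(trmxK v); apply: posdef_add_tr_mul. Qed.

Lemma posdef_unitmx d (A : 'M[R]_d) : posdef A -> A \in unitmx.
Proof.
case=> _ A0; rewrite unitmxE unitfE; apply/negP => /det0P[v v0 vA].
have vT0 : v^T != 0 by rewrite -trmx0 (inj_eq trmx_inj).
by have := A0 _ vT0; rewrite /qform trmxK vA mul0mx mxE ltxx.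
Qed.

Lemma posdef_invmx_sym d (A : 'M[R]_d) : posdef A -> (invmx A)^T = invmx A.
Proof. by case=> As _; rewrite trmx_inv As. Qed.

(** With [w = invmx A *m v], which is nonzero, v^T A^-1 v = w^T A w. *)
Lemma posdef_invmx d (A : 'M[R]_d) : posdef A -> posdef (invmx A).
Proof.
move=> Ap; have Au := posdef_unitmx Ap; have Ls := posdef_invmx_sym Ap.
split=> // v v0; have -> : qform (invmx A) v = qform A (invmx A *m v).
  by rewrite /qform trmx_mul Ls !mulmxA mulmxKV.
apply: Ap.2; apply: contra v0 => /eqP Lv0.
by rewrite -[v](mulKVmx Au) Lv0 mulmx0.
Qed.

Lemma qform_mulmx_sym_ge0 d (L : 'M[R]_d) v : L^T = L -> 0 <= qform (L *m L) v.
Proof. by move=> Ls; rewrite -{1}Ls qform_tr_mul_ge0. Qed.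

(** Source of the trace inequalities: positivity of diagonal entries stands in for eigenvalues,
    which need not exist in [R]. *)
Lemma mxtrace_tr_mul_mul d k (A : 'M[R]_d) (D : 'M[R]_(d, k)) :
  \tr (D^T *m A *m D) = \sum_i qform A (col i D).
Proof.
apply: eq_bigr => i _; rewrite /qform !mxE; apply: eq_bigr => j _.
by rewrite !mxE; congr (_ * _); apply: eq_bigr => l _; rewrite !mxE.
Qed.

Lemma mxtrace_posdef_ge0 d (A : 'M[R]_d) : posdef A -> 0 <= \tr A.
Proof.
move=> Ap; have := mxtrace_tr_mul_mul A 1%:M; rewrite trmx1 mul1mx mulmx1 => ->.
by apply: sumr_ge0 => i _; apply: posdef_qform_ge0.
Qed.

Lemma mxtrace_sqr_sym_ge0 d (L : 'M[R]_d) : L^T = L -> 0 <= \tr (L *m L).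
Proof.
move=> Ls; rewrite -{1}Ls -(mulmx1 L^T) mxtrace_tr_mul_mul.
by apply: sumr_ge0 => i _; apply/posdef_qform_ge0/posdef_scalar/ltr01.
Qed.

(* tr ((N^-1 - c) N (N^-1 - c)) >= 0 *)
Lemma mxtrace_invmx_ge k (N : 'M[R]_k) c :
  posdef N -> c *+ 2 * k%:R - c ^+ 2 * \tr N <= \tr (invmx N).
Proof.
move=> Np; have Nu := posdef_unitmx Np; set L := invmx N.
have Ls : L^T = L by exact: posdef_invmx_sym.
have : 0 <= \tr ((L - c%:M)^T *m N *m (L - c%:M)).
  rewrite mxtrace_tr_mul_mul; apply: sumr_ge0 => i _; exact: posdef_qform_ge0.
have -> : (L - c%:M)^T = L - c%:M by rewrite linearB /= Ls tr_scalar_mx.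
rewrite mulmxBl mulVmx // mul_scalar_mx mulmxBr !mulmxBl !mul1mx -!scalemxAl.
rewrite (mulmxV Nu) mul_mx_scalar scalerA !linearB /= !linearZ /= mxtrace1.
rewrite mxtrace_scalar -mulr_natr => H; rewrite -subr_ge0; apply: le_trans H _.
by rewrite le_eqVlt; apply/orP; left; apply/eqP; ring.
Qed.

(** Sherman-Morrison formula; [e] is 1 for adding a vector and -1 for removing one. The equation on
    [t] is exactly the cancellation of the v v^T A^-1 terms in the product of the two matrices. *)
Lemma invmx_rank1_update d (A : 'M[R]_d) (v : 'cV[R]_d) (e t : R) :
  A \in unitmx -> t * (1 + e * qform (invmx A) v) = e ->
  invmx (A + e *: (v *m v^T)) =
    invmx A - t *: (invmx A *m v *m v^T *m invmx A).
Proof.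
move=> Au te; set L := invmx A; set B := A + _.
have H : B *m (L - t *: (L *m v *m v^T *m L)) = 1%:M.
  rewrite mulmxBr mulmxDl mulmxV // -scalemxAr mulmxDl !mulmxA mulmxV // mul1mx.
  (* The inner factor v^T L v is a 1 x 1 matrix and comes out as the scalar [qform L v]. *)
  have -> : e *: (v *m v^T) *m L *m v *m v^T *m L
       = (e * qform L v) *: (v *m v^T *m L).
    rewrite -!scalemxAl -scalerA; congr (_ *: _).
    rewrite -[v *m v^T *m L *m v]mulmxA -[v *m v^T *m _]mulmxA.
    rewrite [v^T *m _]mx11_scalar mul_mx_scalar -!scalemxAl.
    by rewrite /qform mulmxA.
  rewrite -[X in t *: (X + _)]scale1r -scalerDl scalerA te -scalemxAl.
  by rewrite addrK.
have Bu : B \in unitmx by have [] := mulmx1_unit H.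
by rewrite -[RHS](mulKmx Bu) H mulmx1.
Qed.

Lemma forward_update_invmx d (A : 'M[R]_d) v :
  posdef A -> forward_update (invmx A) v = invmx (A + v *m v^T).
Proof.
move=> Ap; rewrite -[v *m v^T]scale1r.
rewrite (@invmx_rank1_update _ _ _ _ (1 + qform (invmx A) v)^-1) //.
  exact: posdef_unitmx.
rewrite mul1r mulVf // gt_eqF // ltr_pwDl //.
exact/posdef_qform_ge0/posdef_invmx.
Qed.

(* With u = (A + v v^T)^-1 v and q = v^T u, the identity v = (A + v v^T) u
   gives q (1 - q) = u^T A u. *)
Lemma qform_invmx_rank1_lt1 d (A : 'M[R]_d) v :
  posdef A -> qform (invmx (A + v *m v^T)) v < 1.
Proof.
move=> Ap; set B := A + _; have Bp : posdef B by exact: posdef_add_rank1.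
have Bu := posdef_unitmx Bp; have Ls := posdef_invmx_sym Bp.
set u := invmx B *m v; set q := qform _ _.
have qE : (v^T *m u) 0 0 = q by rewrite /q /qform mulmxA.
have E : B *m u = v by rewrite mulKVmx.
have qE' : (u^T *m v) 0 0 = q by rewrite -qE -(trmxK (u^T *m v)) trmx_mul trmxK mxE.
have : q = qform A u + q ^+ 2.
  rewrite -[in LHS]qE' -[v in LHS]E mulmxA /B -/(qform _ u) qformD.
  congr (_ + _); rewrite /qform mulmxA -mulmxA mxE big_ord1 qE.
  by rewrite qE' expr2.
(* If [u] is zero then q = 0; otherwise q - q^2 = u^T A u > 0 forces q < 1. *)
have [u0|u0] := eqVneq u 0.
  by rewrite -qE u0 mulmx0 mxE.
by have := Ap.2 u u0 => H1 H2; nra.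
Qed.

(** Sherman-Morrison with [e = -1]; the denominator 1 - q is positive by [qform_invmx_rank1_lt1]. *)
Lemma backward_update_invmx d (A : 'M[R]_d) v :
  posdef A -> backward_update (invmx (A + v *m v^T)) v = invmx A.
Proof.
move=> Ap; set B := A + _; have Bp : posdef B by exact: posdef_add_rank1.
have -> : invmx A = invmx (B + (-1) *: (v *m v^T)) by rewrite scaleN1r addrK.
rewrite (@invmx_rank1_update _ _ _ _ (- (1 - qform (invmx B) v)^-1)).
- by rewrite /backward_update scaleNr opprK.
- exact: posdef_unitmx.
have : 0 < 1 - qform (invmx B) v by rewrite subr_gt0 qform_invmx_rank1_lt1.
by move=> q1; rewrite mulN1r mulNr mulVf // gt_eqF.
Qed.

Lemma mxtrace_rank1_sandwich d (L : 'M[R]_d) v :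
  \tr (L *m v *m v^T *m L) = qform (L *m L) v.
Proof. by rewrite mxtrace_mulC qform_mxtrace !mulmxA. Qed.

(** This explains the score: it is the exact drop of the trace, so the greedy rule is a best
    one-element change of f. *)
Lemma mxtrace_forward_update d (L : 'M[R]_d) v :
  \tr (forward_update L v) = \tr L - forward_score L v.
Proof.
rewrite /forward_update linearB linearZ /= mxtrace_rank1_sandwich.
by rewrite /forward_score mulrC.
Qed.

Lemma mxtrace_backward_update d (L : 'M[R]_d) v :
  \tr (backward_update L v) = \tr L + backward_score L v.
Proof.
rewrite /backward_update linearD linearZ /= mxtrace_rank1_sandwich.
by rewrite /backward_score mulrC.
Qed.

Lemma forward_score_ge0 d (L : 'M[R]_d) v : posdef L -> 0 <= forward_score L v.
Proof.
move=> Lp; rewrite divr_ge0 ?(qform_mulmx_sym_ge0 _ Lp.1) //.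
by rewrite addr_ge0 ?posdef_qform_ge0.
Qed.

(** At the initial matrix the score increases with the norm, so the first index chosen is that of a
    longest vector. *)
Lemma forward_score_scalar d lam (v : 'cV[R]_d) : 0 < lam ->
  forward_score (lam^-1)%:M v = lam^-1 - (lam + sqnorm v)^-1.
Proof.
move=> lam0; rewrite /forward_score -scalar_mxM !qform_scalar_mx; field.
by rewrite !gt_eqF ?ltr_pwDl ?sqnorm_ge0.
Qed.

(* lam (lam + B B^T)^-1 = 1 - B (lam + B^T B)^-1 B^T *)
Lemma mxtrace_invmx_gram_swap d k (B : 'M[R]_(d, k)) lam : 0 < lam ->
  \tr (invmx (B *m B^T + lam%:M)) =
    (d%:R - k%:R) / lam + \tr (invmx (B^T *m B + lam%:M)).
Proof.
move=> lam0; have lamN0 : lam != 0 by rewrite gt_eqF.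
set X := _ + _; set Y := B^T *m B + _.
have Xp : posdef X.
  rewrite /X addrC -{1}(trmxK B).
  by apply/posdef_add_tr_mul/posdef_scalar.
have Yp : posdef Y by rewrite /Y addrC; apply/posdef_add_tr_mul/posdef_scalar.
have Xu := posdef_unitmx Xp; have Yu := posdef_unitmx Yp.
have XBY : X *m B = B *m Y.
  by rewrite mulmxDl mulmxDr mulmxA mul_mx_scalar mul_scalar_mx.
have H : X *m (1%:M - B *m invmx Y *m B^T) = lam%:M.
  by rewrite mulmxBr mulmx1 !mulmxA XBY mulmxK // /X addrC addKr.
have {}H : lam *: invmx X = 1%:M - B *m invmx Y *m B^T.
  by rewrite -[RHS](mulKmx Xu) H mul_mx_scalar.
apply: (mulfI lamN0); rewrite -linearZ /= H linearB /= mxtrace1.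
have -> : \tr (B *m invmx Y *m B^T) = k%:R - lam * \tr (invmx Y).
  rewrite -mulmxA mxtrace_mulC -mulmxA.
  have -> : B^T *m B = Y - lam%:M by rewrite addrK.
  by rewrite mulmxBr mulVmx // mul_mx_scalar linearB linearZ /= mxtrace1.
by field.
Qed.

End PositiveDefinite.

(** * The objective and the reachable states of the two algorithms *)

Section Greedy.
Variables (R : realFieldType) (n d : nat) (a : 'I_n -> 'cV[R]_d) (lam : R).
Hypothesis lam_gt0 : 0 < lam.
Implicit Types (S T : {set 'I_n}) (i j : 'I_n).

(** Stated for sequences so as to cover also the partial sums met while the initial backward matrix
    is being computed. *)
Lemma posdef_sum_rank1 (s : seq 'I_n) :
  posdef (\sum_(i <- s) a i *m (a i)^T + lam%:M).
Proof.
elim: s => [|i s IH]; first by rewrite big_nil add0r; apply: posdef_scalar.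
by rewrite big_cons -addrA addrC; apply: posdef_add_rank1.
Qed.

Lemma posdef_gram S : posdef (gram a lam S).
Proof. by rewrite /gram -big_enum; apply: posdef_sum_rank1. Qed.

Lemma gram_setU1 S i : i \notin S ->
  gram a lam (i |: S) = gram a lam S + a i *m (a i)^T.
Proof. by move=> iS; rewrite /gram big_setU1 //= -addrA addrC. Qed.

Lemma gram_setD1 S i : i \in S ->
  gram a lam S = gram a lam (S :\ i) + a i *m (a i)^T.
Proof. by move=> iS; rewrite -gram_setU1 ?setD11 // setD1K. Qed.

Lemma forward_update_gram S i : i \notin S ->
  forward_update (invmx (gram a lam S)) (a i) = invmx (gram a lam (i |: S)).
Proof.
by move=> iS; rewrite gram_setU1 // forward_update_invmx //; apply: posdef_gram.
Qed.

Lemma backward_update_gram S i : i \in S ->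
  backward_update (invmx (gram a lam S)) (a i) = invmx (gram a lam (S :\ i)).
Proof.
by move=> /gram_setD1->; rewrite backward_update_invmx //; apply: posdef_gram.
Qed.

Lemma fobj_setU1_le S i : fobj a lam (i |: S) <= fobj a lam S.
Proof.
have [iS|iS] := boolP (i \in S); first by rewrite (setUidPr _) ?sub1set.
rewrite /fobj -forward_update_gram // mxtrace_forward_update gerBl.
exact/forward_score_ge0/posdef_invmx/posdef_gram.
Qed.

Lemma fobj_antitone S T : S \subset T -> fobj a lam T <= fobj a lam S.
Proof.
move/setUidPr <-; rewrite -[T]set_enum; elim: (enum T) => [|i s IH].
  by rewrite set_nil setU0.
by rewrite set_cons setUCA (le_trans (fobj_setU1_le _ _)).
Qed.

Lemma zopt_attained k : (k <= n)%N ->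
  exists2 S : {set 'I_n}, #|S| = k & zopt a lam k = fobj a lam S.
Proof.
(* The default set of the arg min has to satisfy the cardinality constraint; this uses [k <= n]. *)
move=> kn; have k0 : #|[set i : 'I_n | (i < k)%N]| == k.
  rewrite -sum1_card; under eq_bigl do rewrite inE.
  by rewrite -(big_ord_widen n (fun=> 1%N)) // sum1_card card_ord.
by rewrite /zopt; case: arg_minP => [|S /eqP Sk _] //; exists S.
Qed.

(** The updates keep the running matrix equal to the inverse Gram matrix of the current set, which
    links scores to f. *)
Lemma forward_stateP t S L : forward_state a lam t S L ->
  #|S| = t /\ L = invmx (gram a lam S).
Proof.
elim=> [|{}t {}S {}L i _ [<- ->] iS _].
  by rewrite cards0 /gram big_set0 add0r invmx_scalar.
by rewrite cardsU1 iS forward_update_gram.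
Qed.

Lemma backward_stateP t S L : backward_state a lam t S L ->
  (#|S| + t = n)%N /\ L = invmx (gram a lam S).
Proof.
elim=> [|{}t {}S {}L i _ [St ->] iS _]; first by rewrite cardsT card_ord addn0.
rewrite backward_update_gram //; split=> //.
by move: St; rewrite (cardsD1 i S) iS add1n addSnnS.
Qed.

(** * Approximation ratios *)

(** Passing from the d x d to the k x k Gram matrix splits off (d - k)/lam; the remaining trace is
    bounded below by the tangent to 1/x at lam + M. *)
Lemma fobj_ge S M : (forall i, sqnorm (a i) <= M) -> 0 <= M ->
  (d%:R - #|S|%:R) / lam + #|S|%:R / (lam + M) <= fobj a lam S.
Proof.
move=> aM M0; set k := #|S|.
(* The columns of [B] are the vectors indexed by [S], so B B^T is their sum of rank-one matrices. *)
pose B := \matrix_(i < d, j < k) a (enum_val j) i 0.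
have -> : fobj a lam S = \tr (invmx (B *m B^T + lam%:M)).
  rewrite /fobj /gram; congr (\tr (invmx (_ + _))).
  rewrite big_enum_val /=; apply/matrixP => i j; rewrite summxE mxE.
  by apply: eq_bigr => l _; rewrite !mxE big_ord1 !mxE.
rewrite mxtrace_invmx_gram_swap // lerD2l.
have Np : posdef (B^T *m B + lam%:M).
  by rewrite addrC; apply/posdef_add_tr_mul/posdef_scalar.
apply: le_trans (mxtrace_invmx_ge (lam + M)^-1 Np).
have trN : \tr (B^T *m B + lam%:M) <= k%:R * (lam + M).
  rewrite linearD /= mxtrace_scalar mulrDr addrC -[lam *+ k]mulr_natl lerD2l.
  apply: (@le_trans _ _ (\sum_(i < k) M)); last first.
    by rewrite sumr_const card_ord mulr_natl.
  apply: ler_sum => j _; apply: le_trans (aM (enum_val j)).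
  by rewrite sqnormE mxE ler_sum // => l _; rewrite !mxE expr2.
have lM : 0 < lam + M by rewrite ltr_pwDl.
(* With c = 1/(lam + M), the slack 2ck - c^2 tr N - ck equals c^2 (k (lam + M) - tr N). *)
rewrite -subr_ge0; apply: (@le_trans _ _
  ((lam + M)^-1 ^+ 2 * (k%:R * (lam + M) - \tr (B^T *m B + lam%:M)))).
  by rewrite mulr_ge0 ?sqr_ge0 ?subr_ge0.
rewrite le_eqVlt; apply/orP; left; apply/eqP.
by field; rewrite gt_eqF.
Qed.

Lemma forward_greedy_ratio k S : (1 <= k <= d - 1)%N -> (k <= n)%N ->
  forward_output a lam k S ->
  fobj a lam S <= (d%:R - 1) / (d%:R - k%:R) * zopt a lam k.
Proof.
case/andP=> k1 kd kn [L kSL].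
have [i iM iS] : exists2 i, forall j, sqnorm (a j) <= sqnorm (a i) & i \in S.
  (* The induction peels off the last step. At the first step the maximality of the score gives the
     longest vector; later steps keep that index in the set. *)
  elim: kSL k1 {kd kn} => // t {}S {}L i; case: t => [|t] tSL IH iS i_max _.
    inversion tSL; subst; exists i => [j|]; last by rewrite !inE eqxx.
    have := i_max j; rewrite inE !forward_score_scalar // => /(_ isT).
    rewrite lerD2l lerN2 lef_pV2 ?posrE ?ltr_pwDl ?sqnorm_ge0 //.
    by rewrite lerD2l.
  by have [//|j jM jS] := IH; exists j => //; rewrite inE jS orbT.
set M := sqnorm (a i) in iM.
have M0 : 0 <= M := sqnorm_ge0 _.
have SF : fobj a lam S <= d%:R / lam - (lam^-1 - (lam + M)^-1).
  apply: (@le_trans _ _ (fobj a lam [set i])).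
    by apply: fobj_antitone; rewrite sub1set.
  rewrite -[[set i]]setU0 /fobj -forward_update_gram ?inE //.
  rewrite {1}/gram big_set0 add0r invmx_scalar mxtrace_forward_update.
  by rewrite forward_score_scalar // mxtrace_scalar mulr_natl.
have [T Tk ->] := zopt_attained kn.
have := fobj_ge T iM M0; rewrite Tk => TM.
have d1 : 1 <= d%:R - k%:R :> R by rewrite -natrB ?ler1n; lia.
have k1R : 1 <= k%:R :> R by rewrite ler1n.
apply: le_trans SF _; apply: le_trans (ler_wpM2l _ TM); last first.
  rewrite divr_ge0 //; lra.
have lM : 0 < lam + M by rewrite ltr_pwDl.
(* The 1/lam terms cancel, and the gap between the two bounds is d (k - 1) / ((d - k)(lam + M)). *)
rewrite -subr_ge0; apply: (@le_trans _ _
  (d%:R * (k%:R - 1) / ((d%:R - k%:R) * (lam + M)))).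
  by rewrite !mulr_ge0 // ?invr_ge0 ?mulr_ge0 ?subr_ge0 //; lra.
rewrite le_eqVlt; apply/orP; left; apply/eqP; field.
by rewrite !gt_eqF //; lra.
Qed.

(* The minimal score is at most the average of the scores of S weighted by
   1 - a_j^T L a_j, and these weights add up to at least #|S| - d. *)
Lemma backward_step_le S i : (d < #|S|)%N -> i \in S ->
  let L := invmx (gram a lam S) in
  (forall j, j \in S -> backward_score L (a i) <= backward_score L (a j)) ->
  fobj a lam (S :\ i) <=
    (#|S|%:R - d%:R + 1) / (#|S|%:R - d%:R) * fobj a lam S.
Proof.
move=> dS iS L i_min.
have Gp := posdef_gram S; have Gu := posdef_unitmx Gp.
have Lp : posdef L by exact: posdef_invmx.
set r := backward_score L (a i) in i_min.
have w_gt0 j : j \in S -> 0 < 1 - qform L (a j).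
  move=> jS; rewrite subr_gt0 /L (gram_setD1 jS).
  exact/qform_invmx_rank1_lt1/posdef_gram.
have r0 : 0 <= r.
  by rewrite divr_ge0 ?(qform_mulmx_sym_ge0 _ Lp.1) // ltW ?w_gt0.
have gramE : \sum_(j in S) a j *m (a j)^T = gram a lam S - lam%:M.
  by rewrite addrK.
(* [K = L] gives d - lam tr L, and [K = L *m L] gives tr L - lam tr (L L). *)
have sum_qform K : \sum_(j in S) qform K (a j) =
    \tr (K *m gram a lam S) - lam * \tr K.
  under eq_bigr do rewrite qform_mxtrace.
  rewrite -linear_sum /= -mulmx_sumr gramE mulmxBr linearB /=.
  by rewrite mul_mx_scalar linearZ.
have : r * \sum_(j in S) (1 - qform L (a j)) <= \sum_(j in S) qform (L *m L) (a j).
  rewrite mulr_sumr; apply: ler_sum => j jS.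
  by rewrite -ler_pdivlMr ?w_gt0 // i_min.
rewrite sumrB sumr_const !sum_qform mulVmx // mxtrace1 mulmxKV //.
rewrite /fobj -backward_update_gram // -/L mxtrace_backward_update -/r.
have trL := mxtrace_posdef_ge0 Lp.
have trLL := mxtrace_sqr_sym_ge0 Lp.1.
have sd : 0 < #|S|%:R - d%:R :> R by rewrite subr_gt0 ltr_nat.
set s := #|S|%:R in sd *; set D := d%:R in sd *.
(* Both lam terms help: one raises the sum of the weights above s - d, the other lowers the
   right-hand side below tr L. *)
move=> H; have {}H : r * (s - D) <= \tr L.
  apply: le_trans (le_trans H _).
    by rewrite ler_wpM2l // opprB addrCA lerDr mulr_ge0 // ltW.
  by rewrite gerBl mulr_ge0 // ltW.
have -> : (s - D + 1) / (s - D) * \tr L = \tr L + \tr L / (s - D).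
  by field; rewrite gt_eqF.
by rewrite lerD2l ler_pdivlMr.
Qed.

Lemma backward_greedy_ratio k S : (d <= k <= n)%N ->
  backward_output a lam k S ->
  fobj a lam S <= (n%:R - d%:R + 1) / (k%:R - d%:R + 1) * zopt a lam k.
Proof.
case/andP=> dk kn [L].
have [T Tk ->] := zopt_attained kn.
have : (d <= n - (n - k))%N by rewrite subKn.
(* The claim is recast in the number t = n - k of removals, with [T] fixed, for induction on states.
   The bound [d <= n - t] ensures that every removal starts from more than d elements. *)
have {3}-> : k = (n - (n - k))%N by rewrite subKn.
move: (n - k)%N => t dt tSL.
elim: tSL dt => [|{}t {}S {}L i tSL IH iS i_min] dt.
  rewrite subn0 divff ?mul1r ?fobj_antitone ?subsetT // gt_eqF //.
  by rewrite ltr_wpDl // subr_ge0 ler_nat (leq_trans dk).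
have [St LE] := backward_stateP tSL.
have {}IH := IH (leq_trans dt (leq_sub2l n (leqnSn t))).
have S0 : (0 < #|S|)%N by rewrite (cardsD1 i) iS.
have dS : (d < #|S|)%N by lia.
have t1 : (n - t.+1 = #|S|.-1)%N by lia.
rewrite LE in i_min; apply: le_trans (backward_step_le dS iS i_min) _.
have sd : 0 < #|S|%:R - d%:R :> R by rewrite subr_gt0 ltr_nat.
have tS : (n - t = #|S|)%N by lia.
rewrite tS in IH.
(* With s = #|S|, the new denominator is s - d; the numerator s - d + 1 of the step factor cancels
   the denominator of the induction hypothesis. *)
have -> : (n - t.+1)%:R - d%:R + 1 = #|S|%:R - d%:R :> R.
  by rewrite t1 -subn1 natrB ?(leq_trans _ dS) // addrAC subrK.
apply: le_trans (ler_wpM2l _ IH) _; first by rewrite divr_ge0 //; lra.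
rewrite le_eqVlt; apply/orP; left; apply/eqP; field.
by rewrite !gt_eqF //; lra.
Qed.

End Greedy.

(** * Output and cost of the elementary programs *)

Section Programs.
Variable R : realFieldType.

Lemma output_bind A B (p : prog R A) (q : A -> prog R B) :
  output (bind p q) = output (q (output p)).
Proof. by elim: p => [x|b c IH|o x y c IH|x y c IH|p IH] //=; apply: IH. Qed.

Lemma cost_bind A B (p : prog R A) (q : A -> prog R B) :
  cost (bind p q) = (cost p + cost (q (output p)))%N.
Proof.
rewrite /cost /output.
elim: p => [x|b c IH|o x y c IH|x y c IH|p IH] //=; by rewrite IH.
Qed.

Lemma cost_bind_le A B (p : prog R A) (q : A -> prog R B) c1 c2 :
  (cost p <= c1)%N -> (cost (q (output p)) <= c2)%N ->
  (cost (bind p q) <= c1 + c2)%N.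
Proof. by move=> pc qc; rewrite cost_bind leq_add. Qed.

(** The invariant is indexed by the list of indices already processed; the proof generalizes this
    prefix, initially empty. *)
Lemma output_loop_inv I A (body : I -> A -> prog R A) (Inv : seq I -> A -> Prop)
    (s : seq I) x :
  Inv [::] x ->
  (forall t i y, Inv t y -> Inv (rcons t i) (output (body i y))) ->
  Inv s (output (loop s body x)).
Proof.
move=> Inv0 InvS; rewrite -[s]cat0s.
have -> : loop ([::] ++ s) body x = loop s body x by [].
elim: s [::] x Inv0 => [|i s IH] t x Inv_t; first by rewrite cats0.
by rewrite -cat_rcons /= /output /= -/(output _) output_bind; apply/IH/InvS.
Qed.

Lemma cost_loop I A (body : I -> A -> prog R A) (s : seq I) x c :
  (forall i y, (cost (body i y) <= c)%N) ->
  (cost (loop s body x) <= size s * c.+1)%N.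
Proof.
move=> body_c; elim: s x => [|i s IH] x //=.
rewrite /cost /= -/(cost _) cost_bind mulSn addSn ltnS.
exact: leq_add.
Qed.

Lemma cost_loop_enum n A (body : 'I_n -> A -> prog R A) x c :
  (forall i y, (cost (body i y) <= c)%N) ->
  (cost (loop (enum 'I_n) body x) <= n * c.+1)%N.
Proof. by move=> body_c; have := cost_loop (enum 'I_n) x body_c; rewrite size_enum_ord. Qed.

Lemma output_build_mx p q (e : 'I_p -> 'I_q -> prog R R) :
  output (build_mx e) = \matrix_(i, j) output (e i j).
Proof.
rewrite /build_mx output_bind; set P := output _.
suff H : forall i j, i \in enum 'I_p -> P i j = output (e i j).
  by apply/matrixP => i j; rewrite H ?mxE ?mem_enum.
rewrite /P; apply: (output_loop_inv
  (Inv := fun t (A : 'M_(p, q)) =>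
     forall i j, i \in t -> A i j = output (e i j))) => // t i A IH.
set Q := output _.
(* Inner invariant: the visited columns of row [i] hold their final values, and every other entry is
   still that of [A]. *)
suff H : Q = \matrix_(i', j') if (i' == i) && (j' \in enum 'I_q)
     then output (e i' j') else A i' j'.
  move=> i' j; rewrite H mxE mem_enum mem_rcons inE andbT.
  by case: eqP => //= _; apply: IH.
rewrite /Q; apply: (output_loop_inv
  (Inv := fun u B => B = \matrix_(i', j') if (i' == i) && (j' \in u)
     then output (e i' j') else A i' j')) => [|u j B ->].
  by apply/matrixP => i' j'; rewrite mxE in_nil andbF.
rewrite output_bind; apply/matrixP => i' j'; rewrite !mxE mem_rcons inE.
by case: eqP => [->|] //=; case: eqP => [->|].
Qed.

(** Each entry costs [c], one write and one inner loop unit; each row adds one outer loop unit, and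
    the initial constant adds the last. *)
Lemma cost_build_mx p q (e : 'I_p -> 'I_q -> prog R R) c :
  (forall i j, (cost (e i j) <= c)%N) ->
  (cost (build_mx e) <= (p * (q * c.+2).+1).+1)%N.
Proof.
move=> e_c; rewrite /build_mx cost_bind ltnS.
apply: cost_loop_enum => i A.
by apply: cost_loop_enum => j B; rewrite cost_bind addn1 ltnS.
Qed.

Lemma output_sum_prog d (e : 'I_d -> prog R R) :
  output (sum_prog e) = \sum_i output (e i).
Proof.
rewrite /sum_prog output_bind -[RHS]big_enum /=.
apply: (output_loop_inv
  (Inv := fun t s => s = \sum_(i <- t) output (e i))) => [|t i s ->].
  by rewrite big_nil.
by rewrite output_bind -cats1 big_cat big_seq1.
Qed.

Lemma cost_sum_prog d (e : 'I_d -> prog R R) c :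
  (forall i, (cost (e i) <= c)%N) -> (cost (sum_prog e) <= (d * c.+2).+1)%N.
Proof.
move=> e_c; rewrite /sum_prog cost_bind ltnS.
by apply: cost_loop_enum => i s; rewrite cost_bind addn1 ltnS.
Qed.

Lemma output_dot_prog d (u v : 'cV[R]_d) :
  output (dot_prog u v) = (u^T *m v) 0 0.
Proof. by rewrite output_sum_prog mxE; apply: eq_bigr => i _; rewrite mxE. Qed.

Lemma cost_dot_prog d (u v : 'cV[R]_d) : (cost (dot_prog u v) <= (d * 3).+1)%N.
Proof. exact: cost_sum_prog. Qed.

Lemma output_mulmxv_prog d (L : 'M[R]_d) v : output (mulmxv_prog L v) = L *m v.
Proof.
rewrite output_build_mx; apply/matrixP => i j.
by rewrite !mxE output_sum_prog ord1.
Qed.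

Lemma cost_mulmxv_prog d (L : 'M[R]_d) v :
  (0 < d)%N -> (cost (mulmxv_prog L v) <= 8 * d ^ 2)%N.
Proof.
(* The count is 3 d^2 + 4 d + 1; [0 < d] absorbs the lower-order terms. *)
move=> d0; apply: leq_trans (cost_build_mx (c := (d * 3).+1) _) _ => [i _|].
  exact: cost_sum_prog.
nia.
Qed.

Lemma output_mulvmx_prog d v (L : 'M[R]_d) :
  output (mulvmx_prog v L) = v^T *m L.
Proof.
rewrite output_build_mx; apply/matrixP => i j.
rewrite !mxE output_sum_prog ord1.
by apply: eq_bigr => l _; rewrite mxE.
Qed.

Lemma cost_mulvmx_prog d v (L : 'M[R]_d) :
  (0 < d)%N -> (cost (mulvmx_prog v L) <= 8 * d ^ 2)%N.
Proof.
move=> d0; apply: leq_trans (cost_build_mx (c := (d * 3).+1) _) _ => [_ i|].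
  exact: cost_sum_prog.
nia.
Qed.

Lemma output_score_prog d fwd (L : 'M[R]_d) v :
  output (score_prog fwd L v) =
    if fwd then forward_score L v else backward_score L v.
Proof.
rewrite /score_prog !(output_bind, output_mulmxv_prog, output_dot_prog).
by case: fwd; rewrite /output /= /forward_score /backward_score /qform !mulmxA. 
Qed.

(** The product L L is never formed: the numerator is v^T (L (L v)), so two matrix-vector products
    suffice. *)
Lemma cost_score_prog d fwd (L : 'M[R]_d) v :
  (0 < d)%N -> (cost (score_prog fwd L v) <= 27 * d ^ 2)%N.
Proof.
move=> d0; rewrite /score_prog.
apply: (@leq_trans
  (8 * d ^ 2 + (8 * d ^ 2 + ((d * 3).+1 + ((d * 3).+1 + (1 + (1 + 1)))))));
  last by nia.
do 2! [apply: cost_bind_le; first exact: cost_mulmxv_prog].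
do 2! [apply: cost_bind_le; first exact: cost_dot_prog].
by do 2! [apply: cost_bind_le => //].
Qed.

Lemma output_update_prog d fwd (L : 'M[R]_d) v :
  output (update_prog fwd L v) =
    if fwd then forward_update L v else backward_update L v.
Proof.
rewrite /update_prog.
rewrite output_bind output_mulmxv_prog output_bind output_mulvmx_prog.
rewrite output_bind output_dot_prog 2!output_bind output_build_mx mulmxA -/(qform L v).
have uw : forall i j, (L *m v *m v^T *m L) i j = (L *m v) i 0 * (v^T *m L) 0 j.
  by move=> i j; rewrite -mulmxA [LHS]mxE big_ord1.
case: fwd; apply/matrixP => i j; rewrite [LHS]mxE [LHS]/output /= [RHS]mxE;
  congr (_ + _); rewrite [RHS]mxE; first congr (- _); rewrite ?[RHS]mxE uw.
- by rewrite mulrC.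
- by rewrite mulrC.
Qed.

Lemma cost_update_prog d fwd (L : 'M[R]_d) v :
  (0 < d)%N -> (cost (update_prog fwd L v) <= 29 * d ^ 2)%N.
Proof.
move=> d0; rewrite /update_prog.
apply: (@leq_trans (8 * d ^ 2 + (8 * d ^ 2 + ((d * 3).+1 +
  (1 + (1 + (d * (d * 5).+1).+1)))))); last by nia.
apply: cost_bind_le; first exact: cost_mulmxv_prog.
apply: cost_bind_le; first exact: cost_mulvmx_prog.
apply: cost_bind_le; first exact: cost_dot_prog.
do 2! [apply: cost_bind_le => //].
exact: cost_build_mx.
Qed.

Lemma output_scalar_inv_prog d (lam : R) :
  output (scalar_inv_prog d lam) = (lam^-1)%:M.
Proof.
rewrite /scalar_inv_prog 2!output_bind output_build_mx.
apply/matrixP => i j; rewrite !mxE; case: eqP => // _.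
by rewrite /output /= div1r.
Qed.

Lemma cost_scalar_inv_prog d (lam : R) :
  (0 < d)%N -> (cost (scalar_inv_prog d lam) <= 7 * d ^ 2)%N.
Proof.
move=> d0; rewrite /scalar_inv_prog.
apply: (@leq_trans (1 + (1 + (d * (d * 3).+1).+1))); last by nia.
do 2! [apply: cost_bind_le => //].
by apply: cost_build_mx => i j; case: ifP.
Qed.

Lemma select_progP n mx b (S : {set 'I_n}) (score : 'I_n -> prog R R) :
  match output (select_prog mx b S score) with
  | None => forall j, (j \in S) != b
  | Some (i, _) => (i \in S) = b /\ forall j, (j \in S) = b ->
      if mx then output (score j) <= output (score i)
      else output (score i) <= output (score j)
  end.
Proof.
(* [le x y] means that [y] is at least as good as [x], which treats maximum and minimum at once. *)
pose le (x y : R) := if mx then x <= y else y <= x.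
have le_refl x : le x x by rewrite /le lexx if_same.
have le_tr y x z : le x y -> le y z -> le x z.
  by rewrite /le; case: (mx) => xy yz; [apply: le_trans yz | apply: le_trans xy].
have less_le x y : output (if mx then less x y else less y x) = ~~ le y x.
  by rewrite /le; case: (mx); rewrite /output /= ltNge.
have le_total x y : ~~ le x y -> le y x.
  by rewrite -less_le /le; case: (mx); apply: ltW.
pose Inv (t : seq 'I_n) best := match best with
  | None => forall j, j \in t -> (j \in S) != b
  | Some (i, s) => [/\ (i \in S) = b, s = output (score i) &
      forall j, j \in t -> (j \in S) = b -> le (output (score j)) s]
  end.
have : Inv (enum 'I_n) (output (select_prog mx b S score)).
  rewrite /select_prog; apply: output_loop_inv => // t i best.
  rewrite output_bind [output (mem_prog _ _ _)]/(i \in S).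
  have [iS|iS] := eqVneq (i \in S) b; last first.
    case: best => [[i0 s0] [i0S s0E H]|H]; last first.
      by move=> j; rewrite mem_rcons inE => /predU1P[->|/H].
    split=> // j; rewrite mem_rcons inE => /predU1P[-> /eqP|/H//].
    by rewrite (negbTE iS).
  rewrite output_bind; case: best => [[i0 s0] [i0S s0E H]|H]; last first.
    split=> // j; rewrite mem_rcons inE => /predU1P[->//|jt jS].
    by have := H j jt; rewrite jS eqxx.
  rewrite output_bind less_le.
  case: ifPn => [/le_total le_s|/negPn le_s]; split=> // j;
    rewrite mem_rcons inE => /predU1P[->//|jt jS]; last exact: H.
  exact: le_tr (H j jt jS) le_s.
case: (output _) => [[i s] [iS -> H]|H j]; last by rewrite H ?mem_enum.
by split=> // j; apply: H; rewrite mem_enum.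
Qed.

(** The three extra units per index pay for the loop, the membership test and the comparison. *)
Lemma cost_select_prog n mx b (S : {set 'I_n}) (score : 'I_n -> prog R R) c :
  (forall i, (cost (score i) <= c)%N) ->
  (cost (select_prog mx b S score) <= n * c.+3)%N.
Proof.
move=> score_c; apply: cost_loop_enum => i best.
apply: (@leq_trans (1 + (c + 1))); last by rewrite addn1.
apply: cost_bind_le => //; case: ifP => // _.
apply: cost_bind_le => //; case: best => [[i0 s0]|] //.
by rewrite cost_bind; case: mx.
Qed.

(** * Correctness and running time of the two greedy programs *)

Section GreedyPrograms.
Variables (n d : nat) (a : 'I_n -> 'cV[R]_d) (lam : R).
Implicit Types (S : {set 'I_n}) (k : nat).

Lemma forward_prog_correct k : (k <= n)%N -> 0 < lam ->
  forward_output a lam k (output (forward_prog a lam k)).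
Proof.
move=> kn lam0; rewrite /forward_prog output_bind.
have -> : output (loop (enum 'I_n) (fun i S => act R (S :\ i)) set0) = set0.
  apply: (output_loop_inv (Inv := fun _ S => S = set0)) => // t i S ->.
  exact: set0D.
rewrite output_bind output_scalar_inv_prog output_bind.
set st := (X in Ret X.1); exists st.2; rewrite -[k in forward_state _ _ k](size_iota 0).
suff: (size (iota 0 k) <= n)%N ->
    forward_state a lam (size (iota 0 k)) st.1 st.2 by apply; rewrite size_iota.
(* The bound on the iteration count is part of the invariant because it guarantees that an
   unselected index remains. *)
rewrite {}/st; apply: (output_loop_inv (Inv := fun t st => (size t <= n)%N ->
  forward_state a lam (size t) st.1 st.2)) => [_|t i [U L] IH].
  exact: forward_init.
rewrite size_rcons => tn; have {IH} stL : forward_state a lam (size t) U L := IH (ltnW tn).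
have [Ut _] := forward_stateP lam0 stL.
have := select_progP true false U (fun i => score_prog true L (a i)).
rewrite output_bind; case: (output (select_prog _ _ _ _)) => [[j s] [jU j_max]|U_full].
  rewrite output_bind [output (act _ _)]/(j |: U) output_bind output_update_prog.
  apply: forward_step => // [|l /negbTE lU]; first by rewrite jU.
  by have := j_max l lU; rewrite !output_score_prog.
suff UT : U = setT by rewrite -Ut UT cardsT card_ord ltnn in tn.
by apply/setP => j; rewrite inE; apply: contraNT (U_full j) => /negbTE->.
Qed.

Lemma backward_prog_correct k : (k <= n)%N -> 0 < lam ->
  backward_output a lam k (output (backward_prog a lam k)).
Proof.
move=> kn lam0; rewrite /backward_prog output_bind.
have -> : output (loop (enum 'I_n) (fun i S => act R (i |: S)) set0) = setT.
  apply/setP => i; rewrite inE; set S0 := output _.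
  suff : i \in enum 'I_n -> i \in S0 by rewrite mem_enum => ->.
  apply: (output_loop_inv (Inv := fun t S => i \in t -> i \in S)) => // t j S IH.
  rewrite mem_rcons inE => /predU1P[->|/IH iS]; first exact: setU11.
  exact: setU1r.
rewrite output_bind output_scalar_inv_prog output_bind.
set L0 := output (loop (enum 'I_n) _ _); have -> : L0 = invmx (gram a lam setT).
  rewrite {}/L0 /gram (eq_bigl xpredT) => [|i]; last by rewrite inE.
  (* After a prefix of the indices, the matrix is the inverse of the partial Gram matrix over that
     prefix. *)
  rewrite -big_enum; apply: (output_loop_inv (Inv := fun t L =>
    L = invmx (\sum_(i <- t) a i *m (a i)^T + lam%:M))) => [|t i L ->].
    by rewrite big_nil add0r invmx_scalar.
  rewrite output_update_prog forward_update_invmx; last exact: posdef_sum_rank1.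
  by rewrite -cats1 big_cat big_seq1 -!addrA [X in _ + X]addrC.
rewrite output_bind.
set st := (X in Ret X.1); exists st.2.
suff: (size (iota 0 (n - k)) <= n)%N ->
    backward_state a lam (size (iota 0 (n - k))) st.1 st.2.
  by rewrite size_iota leq_subr; apply.
rewrite {}/st; apply: (output_loop_inv (Inv := fun t st => (size t <= n)%N ->
  backward_state a lam (size t) st.1 st.2)) => [_|t i [U L] IH].
  exact: backward_init.
rewrite size_rcons => tn; have {IH} stL : backward_state a lam (size t) U L := IH (ltnW tn).
have [Ut _] := backward_stateP lam0 stL.
have := select_progP false true U (fun i => score_prog false L (a i)).
rewrite output_bind; case: (output (select_prog _ _ _ _)) => [[j s] [jU j_min]|U_empty].
  rewrite output_bind [output (act _ _)]/(U :\ j) output_bind output_update_prog.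
  apply: backward_step => // l lU.
  by have := j_min l lU; rewrite !output_score_prog.
(* A failed selection means that [U] is empty, so n removals would already have been made. *)
suff U0 : U = set0 by rewrite -Ut U0 cards0 ltnn in tn.
by apply/setP => j; rewrite inE; apply/negbTE; have := U_empty j; case: (j \in U).
Qed.

Hypothesis d_gt0 : (0 < d)%N.

(** Initialization costs at most 9 n d^2 and each iteration at most 61 n d^2; [0 < k] lets the
    iterations absorb the former. *)
Lemma cost_forward_prog k : (0 < k)%N -> (0 < n)%N ->
  (cost (forward_prog a lam k) <= 70 * (k * n * d ^ 2))%N.
Proof.
move=> k0 n0; have d20 : (0 < d ^ 2)%N by rewrite expn_gt0 d_gt0.
have nd : (n <= n * d ^ 2)%N by rewrite leq_pmulr.
have dn : (d ^ 2 <= n * d ^ 2)%N by rewrite leq_pmull.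
set c := (n * (27 * d ^ 2).+3 + (1 + (29 * d ^ 2 + 0)))%N.
apply: (@leq_trans (n * 2 + (7 * d ^ 2 + (k * c.+1 + 0)))%N); last first.
  have knd : (n * d ^ 2 <= k * (n * d ^ 2))%N by rewrite leq_pmull.
  have kc : (k * c.+1 <= k * (61 * (n * d ^ 2)))%N.
    by rewrite leq_mul2l /c; apply/orP; right; nia.
  rewrite -mulnA; lia.
apply: cost_bind_le; first exact: cost_loop_enum.
apply: cost_bind_le; first exact: cost_scalar_inv_prog.
apply: cost_bind_le => //.
apply: leq_trans (cost_loop _ _ _) _; last by rewrite size_iota.
move=> _ [U L]; apply: cost_bind_le.
  by apply: cost_select_prog => i; apply: cost_score_prog.
case: (output _) => [[i s]|] //.
by do 2! [apply: cost_bind_le => //]; apply: cost_update_prog.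
Qed.

(** The extra unit in [(n - k).+1] pays for the initial inverse, of order n d^2 even when nothing is
    removed. *)
Lemma cost_backward_prog k : (0 < n)%N ->
  (cost (backward_prog a lam k) <= 100 * ((n - k).+1 * n * d ^ 2))%N.
Proof.
move=> n0; have d20 : (0 < d ^ 2)%N by rewrite expn_gt0 d_gt0.
have nd : (n <= n * d ^ 2)%N by rewrite leq_pmulr.
have dn : (d ^ 2 <= n * d ^ 2)%N by rewrite leq_pmull.
set c := (n * (27 * d ^ 2).+3 + (1 + (29 * d ^ 2 + 0)))%N.
apply: (@leq_trans (n * 2 + (7 * d ^ 2 +
  (n * (29 * d ^ 2).+1 + ((n - k) * c.+1 + 0))))%N); last first.
  have kc : ((n - k) * c.+1 <= (n - k) * (61 * (n * d ^ 2)))%N.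
    by rewrite leq_mul2l /c; apply/orP; right; nia.
  rewrite -mulnA mulSn; nia.
apply: cost_bind_le; first exact: cost_loop_enum.
apply: cost_bind_le; first exact: cost_scalar_inv_prog.
apply: cost_bind_le.
  by apply: cost_loop_enum => i L; apply: cost_update_prog.
apply: cost_bind_le => //.
apply: leq_trans (cost_loop _ _ _) _; last by rewrite size_iota.
move=> _ [U L]; apply: cost_bind_le.
  by apply: cost_select_prog => i; apply: cost_score_prog.
case: (output _) => [[i s]|] //.
by do 2! [apply: cost_bind_le => //]; apply: cost_update_prog.
Qed.

End GreedyPrograms.
End Programs.

Theorem theorem6 (R : realType) :
  (forall (n d k : nat) (a : 'I_n -> 'cV[R]_d) (lam : R),
     (0 < d)%N -> (d <= n)%N -> (0 < k)%N -> (k <= n)%N -> 0 < lam ->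
     ((1 <= k <= d - 1)%N ->
        forall SF : {set 'I_n}, forward_output a lam k SF ->
          fobj a lam SF <= (d%:R - 1) / (d%:R - k%:R) * zopt a lam k)
     /\
     ((d <= k <= n)%N ->
        forall SB : {set 'I_n}, backward_output a lam k SB ->
          fobj a lam SB <=
            (n%:R - d%:R + 1) / (k%:R - d%:R + 1) * zopt a lam k))
  /\
  (exists C : nat,
     forall (n d k : nat) (a : 'I_n -> 'cV[R]_d) (lam : R),
       (0 < d)%N -> (d <= n)%N -> (0 < k)%N -> (k <= n)%N -> 0 < lam ->
       forward_output a lam k (output (forward_prog a lam k)) /\
       (cost (forward_prog a lam k) <= C * (k * n * d ^ 2))%N)
  /\
  (exists C : nat,
     forall (n d k : nat) (a : 'I_n -> 'cV[R]_d) (lam : R),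
       (0 < d)%N -> (d <= n)%N -> (0 < k)%N -> (k <= n)%N -> 0 < lam ->
       backward_output a lam k (output (backward_prog a lam k)) /\
       ((k < n)%N ->
          (cost (backward_prog a lam k) <= C * ((n - k) * n * d ^ 2))%N) /\
       (k = n -> (cost (backward_prog a lam k) <= C * (n * d ^ 2))%N)).
Proof.
split=> [n d k a lam d0 dn k0 kn lam0|].
  split=> [kd SF|kd SB]; first exact: forward_greedy_ratio.
  exact: backward_greedy_ratio.
split.
  exists 70%N => n d k a lam d0 dn k0 kn lam0; split.
    exact: forward_prog_correct.
  by apply: cost_forward_prog => //; apply: leq_trans dn.
exists 200%N => n d k a lam d0 dn k0 kn lam0; split.
  exact: backward_prog_correct.
have H := cost_backward_prog a lam d0 k (leq_trans d0 dn).
(* For k < n the extra unit at most doubles n - k, whence 200 = 2 * 100; for k = n only the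
   initialization remains. *)
split=> [k_lt|k_n]; apply: leq_trans H _.
  have nk : ((n - k).+1 <= 2 * (n - k))%N by lia.
  by rewrite (_ : 200 = 100 * 2)%N // -[leqRHS]mulnA leq_mul // !mulnA !leq_mul.
by rewrite k_n subnn mul1n leq_mul2r orbT.
Qed.
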